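(* Let $n\geq 2$ be an integer, let $\Lambda\geq\lambda>0$, and let $p\in\mathbb{R}$ satisfy either $p<-1$ or $$p>\frac{\frac{\Lambda}{\lambda}(n-1)+2}{\frac{\Lambda}{\lambda}(n-1)} .$$ Then there exists a positive viscosity solution $u$ of the inequality $$\mathcal{M}^-_{\lambda,\Lambda}(D^2u)+u^p\leq0\qquad\text{in }\mathbb{R}^n_+ .$$
   Context: $\mathbb{R}^n_+=\{x=(x',x_n)\in\mathbb{R}^{n-1}\times\mathbb{R} : x_n>0\}$. For a real symmetric $n\times n$ matrix $M$ with eigenvalues $\mu_1,\dots,\mu_n$, the Pucci inf-operator is $\mathcal{M}^-_{\lambda,\Lambda}(M)=\lambda\sum_{\mu_i>0}\mu_i+\Lambda\sum_{\mu_i<0}\mu_i$. A positive viscosity solution of the inequality is a lower semicontinuous function $u:\mathbb{R}^n_+\to(0,+\infty)$ such that, whenever $x_0\in\mathbb{R}^n_+$ and $\varphi$ is a $C^2$ function near $x_0$ such that $u-\varphi$ has a local minimum at $x_0$, one has $\mathcal{M}^-_{\lambda,\Lambda}(D^2\varphi(x_0))+u(x_0)^p\leq0$. *)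

(* Defs.v *)
From mathcomp Require Import all_boot all_order all_algebra.
From mathcomp Require Import all_classical all_reals all_analysis.

Set Implicit Arguments.
Unset Strict Implicit.
Unset Printing Implicit Defensive.

Import Order.TTheory GRing.Theory Num.Theory.
Import numFieldNormedType.Exports.

Local Open Scope classical_set_scope.
Local Open Scope ring_scope.

(* The last coordinate x_n is the one whose 0-based index i satisfies
   i + 1 = n. *)
Definition half_space (R : realType) (n : nat) : set 'rV[R]_n :=
  [set x | forall i : 'I_n, i.+1 = n -> 0 < x 0 i].
Arguments half_space : clear implicits.

(* Eigenvalues listed with multiplicity.  For symmetric M the set below is
   inhabited by the spectral theorem, and any two of its members are
   permutations of each other; [::] is a dummy value used only when
   char_poly M does not split over R. *)
Definition eigenvalues (R : realType) (n : nat) (M : 'M[R]_n) : seq R :=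
  xget [::] [set mus : seq R | char_poly M = \prod_(mu <- mus) ('X - mu%:P)].

Definition pucci_inf (R : realType) (lam Lam : R) (n : nat) (M : 'M[R]_n) : R :=
  lam * (\sum_(mu <- eigenvalues M | 0 < mu) mu) +
  Lam * (\sum_(mu <- eigenvalues M | mu < 0) mu).

Definition partial (R : realType) (n : nat) (i : 'I_n) (f : 'rV[R]_n -> R) :
  'rV[R]_n -> R := 'D_(delta_mx 0 i) f.

Definition hessian (R : realType) (n : nat) (f : 'rV[R]_n -> R)
    (x : 'rV[R]_n) : 'M[R]_n :=
  \matrix_(i, j) partial j (partial i f) x.

(* 'D_v f is total, with a junk value where f is not derivable along v, hence
   the explicit derivability requirements. *)
Definition C2_near (R : realType) (n : nat) (f : 'rV[R]_n -> R)
    (x0 : 'rV[R]_n) : Prop :=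
  \forall x \near x0,
    {for x, continuous f} /\
    forall i : 'I_n,
      [/\ derivable f x (delta_mx 0 i),
          {for x, continuous (partial i f)} &
          forall j : 'I_n,
            derivable (partial i f) x (delta_mx 0 j) /\
            {for x, continuous (partial j (partial i f))}].

(* Lower semicontinuity of the restriction of f to A, for the relative
   topology; the values of f outside A are irrelevant. *)
Definition lower_semicontinuous_on (R : realType) (n : nat)
    (A : set 'rV[R]_n) (f : 'rV[R]_n -> R) : Prop :=
  @lower_semicontinuous (subspace A) R (fun x => (f x)%:E).

(* A function on the half-space is encoded by a total function u, of which only
   the values in the half-space (an open set) matter. *)
Definition positive_viscosity_solution (R : realType) (n : nat)
    (lam Lam p : R) (u : 'rV[R]_n -> R) : Prop :=
  [/\ forall x, half_space R n x -> 0 < u x,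
      lower_semicontinuous_on (half_space R n) u &
      forall (x0 : 'rV[R]_n) (phi : 'rV[R]_n -> R),
        half_space R n x0 ->
        C2_near phi x0 ->
        (\forall x \near x0, u x0 - phi x0 <= u x - phi x) ->
        pucci_inf lam Lam (hessian phi x0) + u x0 `^ p <= 0].

(* Main.v *)
Require Import Defs.
From mathcomp Require Import all_boot all_order all_algebra.
From mathcomp Require Import all_classical all_reals all_analysis.
From mathcomp Require Import complex.
From mathcomp Require Import ring lra.

(** If the symmetric matrix [A = \sum_k a_k b_k^T b_k] satisfies
    [lam |w|^2 <= w A w^T <= Lam |w|^2], then the Pucci inf-operator is at most
    [tr (A M) = \sum_k a_k b_k M b_k^T].  When [phi] touches [u] from below,
    each term of this sum for [M = D^2 phi] is at most [a_k] times the second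
    derivative of [u] along [b_k].  A smooth positive [u] is therefore a
    solution as soon as, at every point, some such frame gives
    [\sum_k a_k \partial_(b_k b_k) u + u^p <= 0].

    For [p < -1] take [u = c x_n^al] with [al = 2 / (1 - p) < 1] and
    [A = Lam I].  For [p] above the critical exponent take
    [u = c x_n |x|^(-be)] with [be = 2 / (p - 1) + 1], and let [A] be [lam] in
    the radial direction and [Lam] orthogonally to it.  Then [tr (A D^2 u)] is
    [- be (Lam (n - 1) - lam (be - 1)) u / |x|^2], negative exactly when
    [be - 1 < (Lam / lam) (n - 1)], and [x_n <= |x|] gives
    [u^p <= c^(p - 1) u / |x|^2]. *)

Import Order.TTheory GRing.Theory Num.Theory.
Import numFieldNormedType.Exports.

Set Implicit Arguments.
Unset Strict Implicit.
Unset Printing Implicit Defensive.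

Local Open Scope classical_set_scope.
Local Open Scope ring_scope.

(** * Spectral theorem and the bound of the Pucci operator by frames *)

Local Notation toC := (real_complex _).

(* [U] and [V] are the real and imaginary parts of a unitary matrix that
   diagonalizes [M] over [R[i]]. *)
Lemma symmetric_spectral (R : rcfType) (n : nat) (M : 'M[R]_n) : M^T = M ->
  exists (mu : 'I_n -> R) (U V : 'M[R]_n),
    [/\ char_poly M = \prod_i ('X - (mu i)%:P),
        forall b : 'rV[R]_n, (b *m M *m b^T) 0 0 =
          \sum_i mu i * ((b *m U^T) 0 i ^+ 2 + (b *m V^T) 0 i ^+ 2) &
        forall i, \sum_j (U i j ^+ 2 + V i j ^+ 2) = 1].
Proof.
move=> symM.
(* Over [R[i]] the real symmetric matrix is Hermitian, hence unitarily diagonalizable with real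
   eigenvalues. *)
pose A := map_mx toC M.
have Aherm : A \is hermsymmx.
  apply: realsym_hermsym.
    apply/is_hermitianmxP; rewrite expr0 scale1r map_mx_id //.
    by apply/matrixP => i j; rewrite !mxE -{1}symM mxE.
  apply/mxOverP => i j; rewrite mxE; apply/complex_realP; by exists (M i j).
have Areal := hermitian_spectral_diag_real Aherm.
have /hermitian_normalmx /orthomx_spectralP := Aherm.
have := spectral_unitarymx A.
move: Areal; set P := spectralmx A; set D := spectral_diag A => Dreal Pu.
have Punit := unitarymx_unit Pu.
rewrite invmx_unitary // => AE.
pose mu i := complex.Re (D 0 i).
have muE i : D 0 i = toC (mu i) by rewrite /mu RRe_real //; apply: (mxOverP Dreal).
exists mu, (map_mx (@complex.Re R) P), (map_mx (@complex.Im R) P).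
have toCM (x y : R) : toC (x * y) = toC x * toC y by exact: rmorphM.
have ReM (b : 'rV[R]_n) i : complex.Re (\sum_j P i j * toC (b 0 j)) =
    \sum_j b 0 j * complex.Re (P i j).
  rewrite (raddf_sum (@complex.Re R)); apply: eq_bigr => j _.
  by case: (P i j) => x y /=; ring.
have ImM (b : 'rV[R]_n) i : complex.Im (\sum_j P i j * toC (b 0 j)) =
    \sum_j b 0 j * complex.Im (P i j).
  rewrite (raddf_sum (@complex.Im R)); apply: eq_bigr => j _.
  by case: (P i j) => x y /=; ring.
split.
- apply: (map_inj_poly (@complexI R)); first by [].
  rewrite rmorph_prod /= map_char_poly -/A.
  (* Similarity: the adjoint of [P] intertwines the two characteristic matrices, and its determinant
     is a nonzero constant that cancels. *)
  have -> : char_poly A = char_poly (diag_mx D).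
    have : char_poly_mx A *m map_mx polyC (P ^t*)%sesqui =
          map_mx polyC (P ^t*)%sesqui *m char_poly_mx (diag_mx D).
      rewrite /char_poly_mx mulmxBl mulmxBr -!map_mxM mul_scalar_mx mul_mx_scalar.
      congr (_ - map_mx _ _); rewrite AE -2!mulmxA -[X in _ *m X]mulmxA.
      by rewrite (unitarymxP Pu) mulmx1.
    move/(congr1 determinant); rewrite !det_mulmx [RHS]mulrC.
    apply: mulIf; rewrite det_map_mx polyC_eq0 -unitfE -unitmxE.
    by rewrite -invmx_unitary // unitmx_inv.
  rewrite char_poly_trig ?diag_mx_trig //; apply: eq_bigr => i _.
  rewrite !mxE eqxx mulr1n muE rmorphB /= map_polyX map_polyC //.
- move=> b; apply: (@complexI R);
  have -> : toC ((b *m M *m b^T) 0 0) = (map_mx toC b *m A *m (map_mx toC b)^T) 0 0.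
    have -> : (map_mx toC b)^T = map_mx toC b^T.
      by apply/matrixP => i j; rewrite !mxE.
    by rewrite -!map_mxM [RHS]mxE.
  (* With [z = P b^T], realness of [b] makes [b P^*] the conjugate of [z], so the form is the sum of
     [mu i * |z_i|^2]. *)
  rewrite AE !mulmxA -mulmxA -(mulmxA _ (diag_mx D)) mxE (raddf_sum (real_complex R)).
  apply: eq_bigr => i _.
  have zE : (P *m (map_mx toC b)^T) i 0 = \sum_j P i j * toC (b 0 j).
    by rewrite mxE; apply: eq_bigr => j _; rewrite !mxE.
  have wE : (map_mx toC b *m (P ^t*)%sesqui) 0 i = (\sum_j P i j * toC (b 0 j))^*.
    rewrite mxE rmorph_sum; apply: eq_bigr => j _; rewrite !mxE rmorphM mulrC.
    by congr (_ * _); rewrite -[LHS]conjc_real.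
  rewrite mul_diag_mx mxE zE wE muE !mxE mulrCA.
  apply: (etrans _ (esym (toCM _ _))); congr (_ * _).
  rewrite mulrC -normCK -add_Re2_Im2 ReM ImM.
  by congr (toC (_ ^+ 2 + _ ^+ 2)); apply: eq_bigr => j _; rewrite !mxE.
- move=> i; apply: (@complexI R);
  have := unitarymxP Pu => /matrixP /(_ i i); rewrite !mxE eqxx => PP1.
  apply: (etrans _ PP1).
  rewrite (raddf_sum (real_complex R)); apply: eq_bigr => j _; rewrite !mxE.
  by rewrite -normCK -add_Re2_Im2.
Qed.

(** Diagonalizing [M] turns the trace into [\sum_i mu i * c i] with [lam <= c i <= Lam]. Replacing
    [c i] by [lam] where [mu i > 0] and by [Lam] where [mu i < 0] can only decrease the sum. *)
Lemma pucci_inf_le_frame (R : realType) (lam Lam : R) (n : nat) (M : 'M[R]_n)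
    (I : finType) (a : I -> R) (b : I -> 'rV[R]_n) :
  M^T = M ->
  (forall w : 'rV[R]_n, lam * \sum_j w 0 j ^+ 2 <=
     \sum_k a k * (b k *m w^T) 0 0 ^+ 2 <= Lam * \sum_j w 0 j ^+ 2) ->
  pucci_inf lam Lam M <= \sum_k a k * (b k *m M *m (b k)^T) 0 0.
Proof.
move=> symM ellA.
have [mu [U [V [charM formM unitUV]]]] := symmetric_spectral symM.
(* [xget] picks some list of roots; unique factorization determines it up to permutation. *)
have eigM : perm_eq (eigenvalues M) [seq mu i | i <- index_enum 'I_n].
  apply: prod_XsubC_eq; rewrite big_map -charM.
  rewrite -(@xgetPex _ [::] [set mus : seq R |
    char_poly M = \prod_(mu <- mus) ('X - mu%:P)]%classic) //.
  by exists [seq mu i | i <- index_enum 'I_n]; rewrite /= big_map.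
pose c i := \sum_k a k * ((b k *m U^T) 0 i ^+ 2 + (b k *m V^T) 0 i ^+ 2).
have -> : \sum_k a k * (b k *m M *m (b k)^T) 0 0 = \sum_i mu i * c i.
  under eq_bigr do rewrite formM mulr_sumr.
  rewrite exchange_big; apply: eq_bigr => i _; rewrite mulr_sumr.
  by apply: eq_bigr => k _; rewrite mulrCA.
rewrite /pucci_inf !(perm_big _ eigM) !big_map !mulr_sumr.
rewrite [X in X + _]big_mkcond [X in _ + X]big_mkcond -big_split.
apply: ler_sum => i _ /=.
have rowE (W : 'M[R]_n) k : (b k *m W^T) 0 i = (b k *m (row i W)^T) 0 0.
  by rewrite !mxE; apply: eq_bigr => j _; rewrite !mxE.
have /andP[c_ge c_le] : lam <= c i <= Lam.
  (* Ellipticity is tested on the real and imaginary parts separately; their squared norms add up to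
     1. *)
  have /andP[U1 U2] := ellA (row i U); have /andP[V1 V2] := ellA (row i V).
  have -> : c i = \sum_k a k * (b k *m (row i U)^T) 0 0 ^+ 2 +
                  \sum_k a k * (b k *m (row i V)^T) 0 0 ^+ 2.
    by rewrite -big_split; apply: eq_bigr => k _; rewrite !rowE mulrDr.
  have unit_i : \sum_j row i U 0 j ^+ 2 + \sum_j row i V 0 j ^+ 2 = 1.
    by rewrite -[RHS](unitUV i) -big_split; apply: eq_bigr => j _; rewrite !mxE.
  by rewrite -(mulr1 lam) -(mulr1 Lam) -unit_i !mulrDr !lerD.
case: ltgtP => [mu_gt0|mu_lt0|<-]; last by rewrite mul0r addr0.
- by rewrite addr0 mulrC ler_pM2l.
- by rewrite add0r mulrC ler_nM2l.
Qed.

(** * Differentiation along lines *)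

Lemma is_derive_line (R : realType) (V : normedModType R) (f : V -> R)
    (x v : V) (t df : R) :
  is_derive (x + t *: v) v f df -> is_derive t 1 (fun s => f (x + s *: v)) df.
Proof.
move=> [fv fdf].
have E : (fun h : R => h^-1 *: (((fun s => f (x + s *: v)) \o shift t) (h *: 1) -
            f (x + t *: v))) =
         (fun h : R => h^-1 *: ((f \o shift (x + t *: v)) (h *: v) - f (x + t *: v))).
  apply/funext => h /=; congr (_ *: (f _ - _)).
  by rewrite [h *: 1]mulr1 scalerDl addrCA.
by split; rewrite /derivable /derive E.
Qed.

Lemma MVT_line (R : realType) (V : normedModType R) (f : V -> R)
    (x v : V) (t : R) :
  (forall s : R, `|s| <= `|t| -> derivable f (x + s *: v) v) ->
  exists2 s, `|s| <= `|t| & f (x + t *: v) - f x = t * 'D_v f (x + s *: v).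
Proof.
move=> dfv; pose g (s : R) := f (x + s *: v).
have dg (s : R) : `|s| <= `|t| -> is_derive s 1 g ('D_v f (x + s *: v)).
  by move=> /dfv /derivableP /is_derive_line.
have cg (a b : R) : (forall s, s \in `[a, b]%R -> `|s| <= `|t|) ->
    {within `[a, b], continuous g}.
  by move=> ab; apply: derivable_within_continuous => s /ab /dg [].
have gt : g t = f (x + t *: v) by [].
have g0 : g 0 = f x by rewrite /g scale0r addr0.
rewrite -gt -g0; have [t_ge0|t_lt0] := leP 0 t.
  have sub s : s \in `[0, t]%R -> `|s| <= t.
    by rewrite in_itv /= => /andP[s0 st]; rewrite ger0_norm.
  have dg' (s : R) : s \in `]0, t[%R -> is_derive s 1 g ('D_v f (x + s *: v)).
    by move=> /subset_itv_oo_cc /sub ?; apply: dg; rewrite (ger0_norm t_ge0).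
  have cg' := cg 0 t (fun s st => le_trans (sub s st) (ler_norm t)).
  have [s /sub st ->] := MVT_segment t_ge0 dg' cg'.
  by exists s; rewrite ?(ger0_norm t_ge0) // subr0 mulrC.
have sub s : s \in `[t, 0]%R -> `|s| <= - t.
  by rewrite in_itv /= => /andP[s0 st]; rewrite ler0_norm // lerN2.
have dg' (s : R) : s \in `]t, 0[%R -> is_derive s 1 g ('D_v f (x + s *: v)).
  by move=> /subset_itv_oo_cc /sub ?; apply: dg; rewrite (ltr0_norm t_lt0).
have cg' : {within `[t, 0], continuous g}.
  by apply: cg => s /sub; rewrite (ltr0_norm t_lt0).
have [s /sub st E] := MVT_segment (ltW t_lt0) dg' cg'.
by exists s; rewrite ?(ltr0_norm t_lt0) // -opprB E sub0r mulrN opprK mulrC.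
Qed.

Lemma near_rV (R : realType) (n : nat) (x : 'rV[R]_n) (P : 'rV[R]_n -> Prop) :
  (\forall y \near x, P y) ->
  exists2 d : R, 0 < d & forall v : 'rV[R]_n, (forall i, `|v 0 i| < d) -> P (x + v).
Proof.
move=> /nbhs_ballP[d d0 dP]; exists d => // v vd; apply: dP; split=> // i j.
by rewrite ord1 -ball_normE /= mxE opprD addNKr normrN.
Qed.

Lemma near_line (R : realType) (n : nat) (x b : 'rV[R]_n) (P : 'rV[R]_n -> Prop) :
  (\forall y \near x, P y) -> \forall t \near (0 : R), P (x + t *: b).
Proof.
move=> xP; have : (x + t *: b) @[t --> (0 : R)] --> x + 0 *: b.
  by apply: cvgD; [exact: cvg_cst|apply: cvgZ; [exact: cvg_id|exact: cvg_cst]].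
by rewrite scale0r addr0; apply.
Qed.

(** Continuous partial derivatives give differentiability: the increment is split into steps
    parallel to the axes, and the mean value theorem compares each step with the partial derivative
    at [x]. *)
Lemma is_derive_partial (R : realType) (n : nat) (f : 'rV[R]_n -> R)
    (x b : 'rV[R]_n) :
  (\forall y \near x, forall i, derivable f y (delta_mx 0 i)) ->
  (forall i, {for x, continuous (partial i f)}) ->
  is_derive x b f (\sum_i b 0 i * partial i f x).
Proof.
move=> df cf.
have approx e : 0 < e -> exists2 d : R, 0 < d & forall v : 'rV[R]_n,
    (forall i, `|v 0 i| < d) ->
    `|f (x + v) - f x - \sum_i v 0 i * partial i f x| <=
      e * \sum_i `|v 0 i|.
  move=> e0.
  have near_close : \forall y \near x, forall i, `|partial i f y - partial i f x| <= e.
    apply: (@filter_forall _ _ (fun i y => `|partial i f y - partial i f x| <= e)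
      (nbhs x) (nbhs_filter x)).
    by move=> i; have /cvgr_distC_le := cf i; apply.
  have := @filterI _ _ (nbhs_filter x) _ _ df near_close.
  move=> /near_rV[d d0 xd]; exists d => // v vd.
  (* [w k] keeps the first [k] coordinates of [v], so [w 0] is zero and [w n] is [v]. *)
  pose w k : 'rV[R]_n := \row_i (if (i < k)%N then v 0 i else 0).
  have step k : (k <= n)%N ->
    `|f (x + w k) - f x - \sum_(i < n | (i < k)%N) v 0 i * partial i f x| <=
      e * \sum_(i < n | (i < k)%N) `|v 0 i|.
    elim: k => [_|k IH kn].
      rewrite !big_pred0 // (_ : w 0%N = 0) ?addr0 ?subrr ?normr0 ?mulr0 //.
      by apply/rowP => i; rewrite !mxE.
    pose j := Ordinal kn.
    have split_sum (F : 'I_n -> R) : \sum_(i < n | (i < k.+1)%N) F i =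
        F j + \sum_(i < n | (i < k)%N) F i.
      rewrite (bigD1 j) //=; congr (_ + _); apply: eq_bigl => i.
      by rewrite ltnS -val_eqE /= ltn_neqAle andbC.
    have wS : w k.+1 = w k + v 0 j *: delta_mx 0 j.
      apply/rowP => i; rewrite !mxE /= eq_sym -val_eqE /= ltnS leq_eqVlt.
      case: (ltngtP i k) => [_|_|ik] /=; rewrite ?mulr0 ?mulr1 ?addr0 ?add0r //.
      by congr (v 0 _); apply: val_inj.
    have small (s : R) : `|s| <= `|v 0 j| ->
        forall i, `|(w k + s *: delta_mx 0 j) 0 i| < d.
      move=> sv i; rewrite !mxE /= eq_sym -val_eqE /=.
      case: (ltngtP i k) => [_|_|ik] /=; rewrite ?mulr0 ?mulr1 ?addr0 ?add0r //.
        by rewrite normr0.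
      exact: le_lt_trans sv (vd _).
    have [s sv|s sv E] := @MVT_line _ _ f (x + w k) (delta_mx 0 j) (v 0 j).
      by rewrite -addrA; case: (xd _ (small s sv)) => + _; apply.
    have [_ /(_ j)] := xd _ (small s sv); rewrite addrA => close.
    rewrite !split_sum wS addrA mulrDr.
    have -> : f (x + w k + v 0 j *: delta_mx 0 j) - f x -
        (v 0 j * partial j f x + \sum_(i < n | (i < k)%N) v 0 i * partial i f x) =
      v 0 j * (partial j f (x + w k + s *: delta_mx 0 j) - partial j f x) +
      (f (x + w k) - f x - \sum_(i < n | (i < k)%N) v 0 i * partial i f x).
      by rewrite mulrBr /(partial j f _) -E; ring.
    apply: le_trans (ler_normD _ _) (lerD _ (IH (ltnW kn))).
    by rewrite normrM mulrC ler_wpM2r.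
  have := step n (leqnn n).
  have -> : w n = v by apply/rowP => i; rewrite mxE ltn_ord.
  by under eq_bigl do rewrite ltn_ord; under [in leRHS]eq_bigl do rewrite ltn_ord.
set D := \sum_i _.
suff cvgD : (fun h : R => h^-1 *: ((f \o shift x) (h *: b) - f x)) @ 0^' --> D.
  by split; [apply/cvg_ex; exists D|apply: cvg_lim].
pose B := \sum_i `|b 0 i|.
have B0 : 0 <= B by apply: sumr_ge0.
apply/cvgrPdist_le => e e0.
(* [B + 1] instead of [B] keeps the denominators positive when [b = 0]. *)
have e'0 : 0 < e / (B + 1) by apply: divr_gt0 => //; lra.
have [d d0 dP] := approx _ e'0.
have dB0 : 0 < d / (B + 1) by apply: divr_gt0 => //; lra.
near=> h.
have hd : `|h| < d / (B + 1) by near: h; exact: dnbhs0_lt.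
have h0 : h != 0 by near: h; exact: nbhs_dnbhs_neq.
have hb i : `|(h *: b) 0 i| < d.
  rewrite mxE normrM; apply: le_lt_trans (_ : `|h| * (B + 1) < d); last first.
    by rewrite -ltr_pdivlMr //; lra.
  apply: ler_wpM2l => //; rewrite /B (bigD1 i) //=.
  by have : 0 <= \sum_(j < n | j != i) `|b 0 j| by [apply: sumr_ge0]; lra.
have := dP _ hb.
have -> : \sum_i (h *: b) 0 i * partial i f x = h * D.
  by rewrite mulr_sumr; apply: eq_bigr => i _; rewrite mxE mulrA.
have -> : \sum_i `|(h *: b) 0 i| = `|h| * B.
  by rewrite mulr_sumr; apply: eq_bigr => i _; rewrite mxE normrM.
move=> H; rewrite distrC /= (addrC (h *: b)).
have -> : h^-1 *: (f (x + h *: b) - f x) - D =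
  h^-1 * (f (x + h *: b) - f x - h * D).
  by rewrite mulrBr mulrA mulVf // mul1r.
have h1 : 0 < `|h| by rewrite normr_gt0.
rewrite normrM normfV ler_pdivrMl //; apply: le_trans H _.
rewrite mulrCA ler_pM2l // mulrAC ler_pdivrMr; last lra.
by rewrite ler_pM2l //; lra.
Unshelve. all: by end_near. Qed.

(** * Symmetry of the Hessian *)

Lemma is_derive_translate (R : realType) (V : normedModType R) (f : V -> R)
    (x v c : V) (df : R) :
  is_derive (x + c) v f df -> is_derive x v (fun y => f (y + c)) df.
Proof.
move=> [fv fdf].
have E : (fun h : R => h^-1 *: (((fun y => f (y + c)) \o shift x) (h *: v) - f (x + c))) =
         (fun h : R => h^-1 *: ((f \o shift (x + c)) (h *: v) - f (x + c))).
  by apply/funext => h /=; rewrite addrA.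
by split; rewrite /derivable /derive E.
Qed.

(** The mean value theorem is applied twice: along [e_i] to the increment [f (y + h e_j) - f y],
    then along [e_j] to [partial i f]. *)
Lemma second_difference (R : realType) (n : nat) (f : 'rV[R]_n -> R)
    (x : 'rV[R]_n) (i j : 'I_n) (h : R) :
  (forall s r, `|s| <= `|h| -> `|r| <= `|h| ->
     let y := x + s *: delta_mx 0 i + r *: delta_mx 0 j in
     derivable f y (delta_mx 0 i) /\ derivable (partial i f) y (delta_mx 0 j)) ->
  exists s r, [/\ `|s| <= `|h|, `|r| <= `|h| &
    f (x + h *: delta_mx 0 i + h *: delta_mx 0 j) - f (x + h *: delta_mx 0 j)
      - f (x + h *: delta_mx 0 i) + f x =
    h * (h * partial j (partial i f) (x + s *: delta_mx 0 i + r *: delta_mx 0 j))].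
Proof.
set e := delta_mx 0 i; set e' := delta_mx 0 j => df.
pose g y := f (y + h *: e') - f y.
have dg s : `|s| <= `|h| -> is_derive (x + s *: e) e g
    (partial i f (x + s *: e + h *: e') - partial i f (x + s *: e)).
  move=> sh.
  have fh_shift : is_derive (x + s *: e) e (fun y => f (y + h *: e'))
      (partial i f (x + s *: e + h *: e')).
    have [/derivableP fh _] := df s h sh (lexx _).
    exact: is_derive_translate.
  have f_at : is_derive (x + s *: e) e f (partial i f (x + s *: e)).
    have := df s 0 sh; rewrite normr0 scale0r addr0 => /(_ (normr_ge0 _))[+ _].
    exact: derivableP.
  exact: (is_deriveB fh_shift f_at).
have [s|s sh gE] := @MVT_line _ _ g x e h; first by case/dg.
have [r|r rh dE] := @MVT_line _ _ (partial i f) (x + s *: e) e' h.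
  by move=> rh; case: (df s r sh rh).
exists s, r; split=> //; rewrite -[partial j _ _]/('D_e' (partial i f) _) -dE.
by have [_ <-] := dg s sh; rewrite -gE /g; ring.
Qed.

(** Schwarz's theorem: the second difference is symmetric in [i] and [j], so the two mixed
    derivatives share a value at points close to [x], and continuity excludes a gap at [x]. *)
Lemma hessian_sym (R : realType) (n : nat) (f : 'rV[R]_n -> R) (x : 'rV[R]_n) :
  C2_near f x -> (hessian f x)^T = hessian f x.
Proof.
move=> C2; apply/matrixP => i j; rewrite !mxE.
apply/eqP; rewrite -subr_eq0 -normr_le0 leNgt; apply/negP => gap.
set a := partial i _ x in gap; set b := partial j _ x in gap.
(* Two errors below a third of the gap cannot add up to the gap. *)
have e0 : 0 < `|a - b| / 3 by lra.
have [_ /(_ j)[_ _ /(_ i)[_ ca]]] := nbhs_singleton C2.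
have [_ /(_ i)[_ _ /(_ j)[_ cb]]] := nbhs_singleton C2.
have /cvgr_dist_lt /(_ _ e0) na := ca; have /cvgr_dist_lt /(_ _ e0) nb := cb.
have [d d0 xd] := near_rV (@filterI _ _ (nbhs_filter x) _ _ C2
  (@filterI _ _ (nbhs_filter x) _ _ na nb)).
(* Two shifts of size [h] must stay together below [d]. *)
pose h := d / 3.
have h0 : 0 < h by rewrite /h; lra.
have hN : `|h| = h by rewrite gtr0_norm.
have small k l (s r : R) : `|s| <= `|h| -> `|r| <= `|h| ->
    forall m, `|(s *: delta_mx 0 k + r *: delta_mx 0 l : 'rV[R]_n) 0 m| < d.
  move=> sh rh m; rewrite !mxE; apply: le_lt_trans (ler_normD _ _) _.
  have le1 (t : R) (c : bool) : `|t * c%:R| <= `|t|.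
    by case: c; rewrite ?mulr1 // mulr0 normr0.
  apply: le_lt_trans (lerD (le1 _ _) (le1 _ _)) _.
  by apply: le_lt_trans (lerD sh rh) _; rewrite hN /h; lra.
have [s1 r1|s1 [r1 [s1h r1h E1]]] := @second_difference _ _ f x i j h.
  move=> sh rh; have [[_ /(_ i)[? _ /(_ j)[? _]]] _] := xd _ (small i j _ _ sh rh).
  by rewrite -addrA.
have [s2 r2|s2 [r2 [s2h r2h E2]]] := @second_difference _ _ f x j i h.
  move=> sh rh; have [[_ /(_ j)[? _ /(_ i)[? _]]] _] := xd _ (small j i _ _ sh rh).
  by rewrite -addrA.
have [_ [_ /=]] := xd _ (small i j _ _ s1h r1h); rewrite addrA.
have [_ [/= + _]] := xd _ (small j i _ _ s2h r2h); rewrite addrA.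
set A := partial i (partial j f) _ in E2 *; set B := partial j (partial i f) _ in E1 *.
clearbody A B.
have <- : A = B.
  apply: (mulfI (lt0r_neq0 h0)); apply: (mulfI (lt0r_neq0 h0)).
  rewrite -E1 -E2 (addrAC x (h *: delta_mx 0 j)); congr (_ + _); exact: addrAC.
rewrite -/a -/b; clearbody a b => aA bA.
have : `|a - b| <= `|a - A| + `|b - A| by rewrite (distrC b); apply: ler_distD.
lra.
Qed.

(** * The second-order test at a touching point *)

(** [psi1] vanishes at the minimum. If [psi2 < 0], then [psi1] is negative just to the right of 0,
    and the mean value theorem makes [psi] drop below [psi 0]. *)
Lemma second_derivative_ge0_at_min (R : realType) (psi psi1 : R -> R) (psi2 : R) :
  (\forall t \near (0 : R), is_derive (t : R) 1 psi (psi1 t)) ->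
  is_derive (0 : R) 1 psi1 psi2 ->
  (\forall t \near (0 : R), psi 0 <= psi t) -> 0 <= psi2.
Proof.
move=> dpsi [dpsi1 <-] psi_min; rewrite leNgt; apply/negP => psi2_lt0.
have lt0 : \forall t \near (0 : R), t != 0 -> t^-1 * (psi1 t - psi1 0) < 0.
  have /cvgr_lt /(_ _ psi2_lt0) := dpsi1; rewrite near_withinE.
  apply: filterS => t H /H; by rewrite /= addr0 [t *: 1]mulr1.
have /nbhs_ballP[d /= d0 dP] := @filterI _ _ (nbhs_filter (0 : R)) _ _
  (@filterI _ _ (nbhs_filter (0 : R)) _ _ dpsi psi_min) lt0.
have {}dP t : `|t| < d -> [/\ is_derive (t : R) 1 psi (psi1 t), psi 0 <= psi t &
    t != 0 -> t^-1 * (psi1 t - psi1 0) < 0].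
  move=> td; have [|[? ?] ?] := dP t; first by rewrite -ball_normE /= sub0r normrN.
  by split.
have ballI t : t \in `]- d, d[%R -> `|t| < d by rewrite in_itv /= ltr_norml.
have psi10 : psi1 0 = 0.
  have [_ psi'0] : is_derive (0 : R) 1 psi 0.
    apply: (@derive1_at_min _ psi (- d) d) => [|t /ballI /dP[[]]||t /ballI /dP[]] //.
      by rewrite ge0_cp // ltW.
    by rewrite in_itv /= oppr_lt0 d0.
  by have [|[_ <-] _ _] := dP 0; first by rewrite normr0.
have d20 : 0 < d / 2 by lra.
have inball t : t \in `[0, d / 2]%R -> `|t| < d.
  by rewrite in_itv /= => /andP[t0 td]; rewrite ger0_norm //; lra.
have [c cd E] : exists2 c, c \in `]0, d / 2[%R &
    psi (d / 2) - psi 0 = psi1 c * (d / 2 - 0).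
  apply: MVT => // [t /subset_itv_oo_cc /inball /dP[] //|].
  by apply: derivable_within_continuous => t /inball /dP[[]].
have := cd; rewrite in_itv /= => /andP[c0 _].
have [_ _ /(_ (lt0r_neq0 c0))] := dP c (inball _ (subset_itv_oo_cc cd)).
rewrite psi10 subr0 pmulr_rlt0 ?invr_gt0 // => c_lt0.
have [|_ + _] := dP (d / 2); first by rewrite gtr0_norm; lra.
by rewrite -subr_ge0 E subr0 pmulr_lge0 // leNgt c_lt0.
Qed.

(** On the line through [x] in direction [b], [u - phi] has a minimum at [t = 0], and the second
    derivative of [phi] there is the Hessian form at [b]. *)
Lemma hessian_le_second_derivative (R : realType) (n : nat)
    (u phi : 'rV[R]_n -> R) (x b : 'rV[R]_n) (g1 : R -> R) (g2 : R) :
  C2_near phi x -> (\forall y \near x, u x - phi x <= u y - phi y) ->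
  (\forall t \near (0 : R), is_derive (t : R) 1 (fun t => u (x + t *: b)) (g1 t)) ->
  is_derive (0 : R) 1 g1 g2 ->
  (b *m hessian phi x *m b^T) 0 0 <= g2.
Proof.
move=> C2 touch du du1; rewrite -subr_ge0.
pose phi1 t := \sum_i b 0 i * partial i phi (x + t *: b).
apply: (@second_derivative_ge0_at_min _ (fun t => u (x + t *: b) - phi (x + t *: b))
  (fun t => g1 t - phi1 t)).
(* The first derivative of [phi] is needed at all nearby points of the line, each of which has a
   neighbourhood where [phi] is regular. *)
- have dphi := near_line b (nbhs_interior C2).
  apply: filterS2 du dphi => t gt C2t; apply: is_deriveB.
  apply: is_derive_line; apply: is_derive_partial.
    by apply: filterS C2t => y [_ yC] i; case: (yC i).
  by move=> i; have [_ /(_ i)[]] := nbhs_singleton C2t.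
- apply: is_deriveB.
  have -> : (b *m hessian phi x *m b^T) 0 0 =
      \sum_i b 0 i * \sum_j b 0 j * partial j (partial i phi) x.
    rewrite -mulmxA mxE; apply: eq_bigr => i _; congr (_ * _).
    by rewrite mxE; apply: eq_bigr => j _; rewrite !mxE mulrC.
  have -> : phi1 = \sum_i (fun t => b 0 i * partial i phi (x + t *: b)).
    by apply/funext => t; rewrite fct_sumE.
  apply: is_derive_sum => i; apply: is_deriveZ; apply: is_derive_line.
  rewrite scale0r addr0; apply: is_derive_partial.
    by apply: filterS C2 => y [_ yC] j; have [_ _ /(_ j)[]] := yC i.
  by move=> j; have [_ /(_ i)[_ _ /(_ j)[]]] := nbhs_singleton C2.
- by rewrite scale0r addr0; exact: near_line touch.
Qed.

(** * Derivatives of an affine function times a power of a quadratic one *)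

Lemma is_derive_affine (R : realType) (a b t : R) :
  is_derive t 1 (fun t => a + b * t) b.
Proof.
have d := is_deriveD (is_derive_cst a t 1) (is_deriveZ b (is_derive_id t 1)).
by apply: (is_derive_eq d); rewrite add0r [_ *: _]mulr1.
Qed.

Lemma is_derive_mul (R : realType) (f g : R -> R) (t df dg : R) :
  is_derive t 1 f df -> is_derive t 1 g dg ->
  is_derive t 1 (fun t => f t * g t) (f t * dg + g t * df).
Proof. by move=> fd gd; apply: is_deriveM. Qed.

Lemma is_derive_quadratic_powR (R : realType) (q0 q1 q2 s t : R) :
  0 < q0 + q1 * t + q2 * t ^+ 2 ->
  is_derive t 1 (fun t => (q0 + q1 * t + q2 * t ^+ 2) `^ s)
    (s * (q1 + 2 * q2 * t) * (q0 + q1 * t + q2 * t ^+ 2) `^ (s - 1)).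
Proof.
pose q r := q0 + q1 * r + q2 * r ^+ 2; rewrite -/(q t) => q_gt0.
have dq : is_derive t 1 q (q1 + 2 * q2 * t).
  have d2 := is_derive_mul (is_derive_affine 0 q2 t) (is_derive_id t 1).
  have := is_deriveD (is_derive_affine q0 q1 t) d2.
  have -> : (fun r => q0 + q1 * r) + (fun r => (0 + q2 * r) * id r) = q.
    by apply/funext => r; rewrite fctE /q add0r expr2 mulrA.
  move=> d; apply: (is_derive_eq d); rewrite /id; clear; ring.
have d := is_derive1_comp (is_derive1_powR s q_gt0) dq.
apply: (is_derive_eq d); move: (_ `^ _) => P; clear; ring.
Qed.

Lemma near_quadratic_gt0 (R : realType) (q0 q1 q2 : R) : 0 < q0 ->
  \forall t \near (0 : R), 0 < q0 + q1 * t + q2 * t ^+ 2.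
Proof.
move=> q_gt0; have : q0 + q1 * t + q2 * t ^+ 2 @[t --> (0 : R)] -->
    q0 + q1 * 0 + q2 * 0 ^+ 2.
  apply: cvgD; first by apply: cvgD;
    [exact: cvg_cst|apply: cvgM; [exact: cvg_cst|exact: cvg_id]].
  apply: cvgM; first exact: cvg_cst.
  exact: exprn_continuous.
by rewrite mulr0 addr0 expr0n /= mulr0 addr0 => /cvgr_gt; apply.
Qed.

(** Both explicit solutions have this form on lines: for [c x_n^al] the affine factor is constant
    and the base is [x_n]; for [c x_n |x|^(-be)] the factor is [c x_n] and the base is [|x|^2]. *)
Lemma is_derive_affine_powR (R : realType) (l0 l1 q0 q1 q2 s : R)
    (q := fun t => q0 + q1 * t + q2 * t ^+ 2)
    (g1 := fun t => l1 * q t `^ s +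
      (l0 + l1 * t) * (s * (q1 + 2 * q2 * t) * q t `^ (s - 1))) :
  0 < q0 ->
  (\forall t \near (0 : R),
     is_derive (t : R) 1 (fun t => (l0 + l1 * t) * q t `^ s) (g1 t)) /\
  is_derive (0 : R) 1 g1
    (2 * l1 * s * q1 * q0 `^ (s - 1) +
     l0 * s * ((s - 1) * q1 ^+ 2 * q0 `^ (s - 2) + 2 * q2 * q0 `^ (s - 1))).
Proof.
move=> q_gt0.
split.
  apply: filterS (near_quadratic_gt0 q1 q2 q_gt0) => t qt_gt0.
  apply: (is_derive_eq
    (is_derive_mul (is_derive_affine l0 l1 t) (is_derive_quadratic_powR s qt_gt0))).
  rewrite /g1 addrC; congr (_ + _); exact: mulrC.
have q0E : q 0 = q0 by rewrite /q; ring.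
have q0_gt0 : 0 < q 0 by rewrite q0E.
have dq r := is_derive_quadratic_powR r q0_gt0.
have E : g1 = (fun t => l1 * q t `^ s) +
    (fun t => (l0 + l1 * t) * ((s * q1 + 2 * s * q2 * t) * q t `^ (s - 1))).
  apply/funext => t; rewrite fctE /g1; congr (_ + _ * (_ * _)); clear; ring.
have d1 := is_derive_mul (is_derive_cst l1 (0 : R) (1 : R)) (dq s).
have d2 := is_derive_mul (is_derive_affine l0 l1 0)
  (is_derive_mul (is_derive_affine (s * q1) (2 * s * q2) 0) (dq (s - 1))).
rewrite E; apply: (is_derive_eq (is_deriveD d1 d2)).
rewrite -!/(q 0) q0E (_ : s - 1 - 1 = s - 2); last by ring.
rewrite /cst; move: (_ `^ s) (_ `^ (s - 1)) (_ `^ (s - 2)) => P P1 P2; clear; ring.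
Qed.

(** * From smooth supersolutions to viscosity solutions *)

Lemma lower_semicontinuous_on_open (R : realType) (n : nat) (A : set 'rV[R]_n)
    (f : 'rV[R]_n -> R) :
  (forall x, A x -> {for x, continuous f}) -> lower_semicontinuous_on A f.
Proof.
move=> cf x a; rewrite lte_fin => afx.
have [Ax|nAx] := pselect (A x); last first.
  (* Points outside [A] are isolated in the subspace topology. *)
  exists [set x]; first by rewrite /nbhs /= -nbhs_subspace_out.
  by move=> y ->; rewrite lte_fin.
exists [set y | a < f y]; last by move=> y; rewrite lte_fin.
rewrite /nbhs /= -nbhs_subspace_in //.
have /cvgr_gt /(_ _ afx) fgt := cf _ Ax.
by apply: filterS fgt => y ay _.
Qed.

(** The frame and its weights may change with the point. [g1] and [g2] supply the derivatives of [u]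
    along the frame lines, so no Hessian of [u] has to be computed. *)
Lemma positive_viscosity_solution_frame (R : realType) (n : nat)
    (lam Lam p : R) (u : 'rV[R]_n -> R) (I : finType) :
  (forall x, half_space R n x -> 0 < u x) ->
  (forall x, half_space R n x -> {for x, continuous u}) ->
  (forall x, half_space R n x ->
     exists (a : I -> R) (b : I -> 'rV[R]_n) (g1 : I -> R -> R) (g2 : I -> R),
     [/\ forall k, 0 <= a k,
         forall w : 'rV[R]_n, lam * \sum_j w 0 j ^+ 2 <=
           \sum_k a k * (b k *m w^T) 0 0 ^+ 2 <= Lam * \sum_j w 0 j ^+ 2,
         forall k, (\forall t \near (0 : R),
             is_derive (t : R) 1 (fun t => u (x + t *: b k)) (g1 k t)) /\
           is_derive (0 : R) 1 (g1 k) (g2 k) &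
         \sum_k a k * g2 k + u x `^ p <= 0]) ->
  positive_viscosity_solution lam Lam p u.
Proof.
move=> u_gt0 cu super; split=> //; first exact: lower_semicontinuous_on_open.
move=> x phi hx C2 touch; have [a [b [g1 [g2 [a0 ellA dg le0]]]]] := super x hx.
apply: le_trans le0; rewrite lerD2r.
apply: le_trans (pucci_inf_le_frame (hessian_sym C2) ellA) _.
apply: ler_sum => k _; apply: ler_wpM2l => //.
by have [d1 d2] := dg k; exact: hessian_le_second_derivative C2 touch d1 d2.
Qed.

(** * The case of exponents below -1 *)

Lemma powR_continuous (R : realType) (s a : R) : 0 < a ->
  {for a, continuous (fun x => x `^ s)}.
Proof.
move=> a_gt0; apply/differentiable_continuous/derivable1_diffP.
by have [] := is_derive1_powR s a_gt0.
Qed.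

Lemma sum_delta (R : pzRingType) (n : nat) (k : 'I_n) (F : 'I_n -> R) :
  \sum_i (i == k)%:R * F i = F k.
Proof.
rewrite (bigD1 k) //= eqxx mul1r big1 ?addr0 // => i /negPf ->.
by rewrite mul0r.
Qed.

Lemma sqnorm_line (R : comPzRingType) (n : nat) (x b : 'rV[R]_n) (t : R) :
  \sum_i (x + t *: b) 0 i ^+ 2 =
  \sum_i x 0 i ^+ 2 + 2 * (\sum_i x 0 i * b 0 i) * t + (\sum_i b 0 i ^+ 2) * t ^+ 2.
Proof.
rewrite -mulrA !mulr_suml !mulr_sumr -!big_split /=; apply: eq_bigr => i _.
by rewrite !mxE; ring.
Qed.

(** With [c] the power on the left, this reads [c^p = c A]: the scaling of a profile that balances a
    linear term of size [A] against the power [p]. *)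
Lemma powR_balance (R : realType) (A p : R) : 0 < A -> p != 1 ->
  (A `^ (p - 1)^-1) `^ p = A `^ (p - 1)^-1 * A.
Proof.
move=> A_gt0 p1; set c := A `^ _.
have c_gt0 : 0 < c by apply: powR_gt0.
have -> : A = c `^ (p - 1) by rewrite -powRrM mulVf ?powRr1 ?(ltW A_gt0) // subr_eq0.
rewrite -{2}(powRr1 (ltW c_gt0)) -powRD; first by congr (_ `^ _); ring.
by rewrite (gt_eqF c_gt0) implybT.
Qed.

Lemma exists_solution_small_exponent (R : realType) (n : nat) (lam Lam p : R) :
  (0 < n)%N -> 0 < lam -> lam <= Lam -> p < -1 ->
  exists u : 'rV[R]_n -> R, positive_viscosity_solution lam Lam p u.
Proof.
move=> n_gt0 lam_gt0 lamLam p_lt; have Lam_gt0 := lt_le_trans lam_gt0 lamLam.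
have [j jn] : exists j : 'I_n, j.+1 = n.
  by case: n n_gt0 => // m _; exists ord_max.
(* Chosen so that [al * p = al - 2], which matches the powers of [x_n]; [al < 1] amounts to
   [p < -1]. *)
pose al := 2 / (1 - p).
have p1_gt0 : 0 < 1 - p by lra.
have al_gt0 : 0 < al by apply: divr_gt0.
have al_lt1 : al < 1 by rewrite ltr_pdivrMr // mul1r; lra.
(* [Lam] times the second derivative of [x_n^al] is [- A x_n^(al - 2)]. *)
pose A := Lam * (al * (1 - al)).
have A_gt0 : 0 < A by do 2![apply: mulr_gt0 => //]; lra.
pose c := A `^ (p - 1)^-1.
have c_gt0 : 0 < c by apply: powR_gt0.
pose u (x : 'rV[R]_n) := c * x 0 j `^ al.
exists u; apply: (@positive_viscosity_solution_frame _ _ _ _ _ _ 'I_n).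
- by move=> x /(_ j jn) xj; rewrite mulr_gt0 // powR_gt0.
- move=> x /(_ j jn) xj.
  have powc := @continuous_comp _ _ _ (fun y : 'rV[R]_n => y 0 j)
    (fun r : R => r `^ al) x (@coord_continuous R 1 n 0 j x) (powR_continuous xj).
  exact: continuousM (@cst_continuous _ _ c x) powc.
move=> x /(_ j jn) xj.
pose d k : R := (k == j)%:R.
(* The frame is the standard basis. The zero terms keep the shape of [is_derive_affine_powR] with
   [l1 = 0] and [q2 = 0]; only the direction [j] contributes. *)
exists (fun=> Lam), (fun k => delta_mx 0 k),
  (fun k t => 0 * (x 0 j + d k * t + 0 * t ^+ 2) `^ al +
    (c + 0 * t) * (al * (d k + 2 * 0 * t) *
      (x 0 j + d k * t + 0 * t ^+ 2) `^ (al - 1))),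
  (fun k => 2 * 0 * al * d k * x 0 j `^ (al - 1) +
    c * al * ((al - 1) * d k ^+ 2 * x 0 j `^ (al - 2) + 2 * 0 * x 0 j `^ (al - 1))).
split.
- by move=> k; exact: ltW.
- move=> w; rewrite -mulr_sumr.
  have -> : \sum_k ((delta_mx 0 k : 'rV_n) *m w^T) 0 0 ^+ 2 = \sum_k w 0 k ^+ 2.
    apply: eq_bigr => k _; congr (_ ^+ 2); rewrite mxE -(sum_delta k (w 0)).
    by apply: eq_bigr => i _; rewrite !mxE eqxx.
  by rewrite lexx andbT ler_wpM2r // sumr_ge0 // => i _; exact: sqr_ge0.
- move=> k; have [d1 d2] := is_derive_affine_powR c 0 (d k) 0 al xj.
  split=> //; apply: filterS d1 => t.
  have -> // : (fun t => u (x + t *: delta_mx 0 k)) =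
    (fun t => (c + 0 * t) * (x 0 j + d k * t + 0 * t ^+ 2) `^ al).
  apply/funext => r; rewrite /u !mxE eqxx /= eq_sym -/(d k).
  by rewrite !mul0r !addr0 (mulrC r).
- rewrite -mulr_sumr.
  have -> : \sum_k (2 * 0 * al * d k * x 0 j `^ (al - 1) +
    c * al * ((al - 1) * d k ^+ 2 * x 0 j `^ (al - 2) + 2 * 0 * x 0 j `^ (al - 1))) =
    c * al * (al - 1) * x 0 j `^ (al - 2).
    rewrite -[RHS](sum_delta j (fun=> c * al * (al - 1) * x 0 j `^ (al - 2)));
      apply: eq_bigr => k _; rewrite /d.
    by case: (k == j); rewrite /=; ring.
  have -> : u x `^ p = c * A * x 0 j `^ (al - 2).
    rewrite /u powRM ?powR_ge0 ?(ltW c_gt0) // -powRrM powR_balance //; last first.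
      by rewrite lt_eqF //; lra.
    congr (_ * _ `^ _); rewrite /al; field; lra.
  rewrite (_ : _ + _ = 0) // /A; move: (_ `^ _) => P; ring.
Qed.

(** * The tangential frame and the case of exponents above the critical one *)

Lemma sqnorm_continuous (R : realType) (n : nat) (x : 'rV[R]_n) :
  {for x, continuous (fun y : 'rV[R]_n => \sum_i y 0 i ^+ 2)}.
Proof.
have -> : (fun y : 'rV[R]_n => \sum_i y 0 i ^+ 2) =
    \sum_i ((fun y : 'rV[R]_n => y 0 i) ^+ 2 : 'rV[R]_n -> R).
  by apply/funext => y; rewrite fct_sumE; apply: eq_bigr => i _; rewrite !fctE.
apply/differentiable_continuous/differentiable_sum => i.
exact/differentiableX/differentiable_coord.
Qed.

(* The orthogonal projections of the standard basis onto the hyperplane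
   orthogonal to [x], which form a Parseval frame of that hyperplane. *)
Definition orth_frame (R : fieldType) (n : nat) (x : 'rV[R]_n) (k : 'I_n) :
  'rV[R]_n := delta_mx 0 k - (x 0 k / \sum_i x 0 i ^+ 2) *: x.

Lemma orth_frame_dot (R : fieldType) (n : nat) (x w : 'rV[R]_n) (k : 'I_n) :
  \sum_i w 0 i * orth_frame x k 0 i =
  w 0 k - x 0 k / (\sum_i x 0 i ^+ 2) * \sum_i x 0 i * w 0 i.
Proof.
rewrite -[X in X - _](sum_delta k (w 0)) mulr_sumr -sumrB.
by apply: eq_bigr => i _; rewrite !mxE eqxx /=; ring.
Qed.

Lemma orth_frame_dot_self (R : fieldType) (n : nat) (x : 'rV[R]_n) (k : 'I_n) :
  \sum_i x 0 i ^+ 2 != 0 -> \sum_i x 0 i * orth_frame x k 0 i = 0.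
Proof.
move=> N_neq0; rewrite orth_frame_dot; under [X in _ * X]eq_bigr do rewrite -expr2.
by rewrite divfK // subrr.
Qed.

(** This is the trace of the projection onto the hyperplane, hence its dimension. *)
Lemma sum_orth_frame_sqnorm (R : fieldType) (n : nat) (x : 'rV[R]_n) :
  \sum_i x 0 i ^+ 2 != 0 ->
  \sum_k \sum_i orth_frame x k 0 i ^+ 2 = n%:R - 1.
Proof.
move=> N_neq0.
have sqE k : \sum_i orth_frame x k 0 i ^+ 2 = 1 - x 0 k ^+ 2 / \sum_i x 0 i ^+ 2.
  under eq_bigr do rewrite expr2.
  rewrite orth_frame_dot orth_frame_dot_self // mulr0 subr0 !mxE !eqxx /=.
  by rewrite expr2 mulrAC.
under eq_bigr do rewrite sqE.
by rewrite sumrB sumr_const card_ord -mulr_suml divff.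
Qed.

(** Parseval's identity: by Pythagoras the right side is the squared norm of the projection of
    [w]. *)
Lemma sum_orth_frame_dot_sq (R : fieldType) (n : nat) (x w : 'rV[R]_n) :
  \sum_i x 0 i ^+ 2 != 0 ->
  \sum_k (\sum_i w 0 i * orth_frame x k 0 i) ^+ 2 =
  \sum_i w 0 i ^+ 2 - (\sum_i x 0 i * w 0 i) ^+ 2 / \sum_i x 0 i ^+ 2.
Proof.
move=> N_neq0; under eq_bigr do rewrite orth_frame_dot.
set m := \sum_i x 0 i * w 0 i; set N := \sum_i x 0 i ^+ 2 in N_neq0 *.
have -> : \sum_k (w 0 k - x 0 k / N * m) ^+ 2 = \sum_k (w 0 k ^+ 2 +
    (- (2 * m / N) * (x 0 k * w 0 k) + m ^+ 2 / N ^+ 2 * x 0 k ^+ 2)).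
  by apply: eq_bigr => k _; field.
rewrite !big_split /= -!mulr_sumr -/m -/N.
by field.
Qed.

Lemma exists_solution_large_exponent (R : realType) (n : nat) (lam Lam p : R) :
  (2 <= n)%N -> 0 < lam -> lam <= Lam ->
  (Lam / lam * (n%:R - 1) + 2) / (Lam / lam * (n%:R - 1)) < p ->
  exists u : 'rV[R]_n -> R, positive_viscosity_solution lam Lam p u.
Proof.
move=> n_ge2 lam_gt0 lamLam p_gt; have Lam_gt0 := lt_le_trans lam_gt0 lamLam.
have [j jn] : exists j : 'I_n, j.+1 = n.
  by case: n n_ge2 {p_gt} => // m _; exists ord_max.
pose m : R := n%:R - 1.
have m_gt0 : 0 < m by rewrite subr_gt0 ltr1n.
have om_gt0 : 0 < Lam / lam * m by rewrite mulr_gt0 // divr_gt0.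
have p1_gt : 2 / (Lam / lam * m) < p - 1.
  move: p_gt; rewrite -/m mulrDl divff ?gt_eqF //; lra.
have p1_gt0 : 0 < p - 1 by apply: lt_trans p1_gt; rewrite divr_gt0.
(* [ga] is [be - 1]; the bound on [p] becomes [lam * ga < Lam * m]. *)
pose ga := 2 / (p - 1).
have ga_gt0 : 0 < ga by rewrite divr_gt0.
have ga_lt : lam * ga < Lam * m.
  move: p1_gt; rewrite ltr_pdivrMr // => p1_gt.
  rewrite /ga mulrA ltr_pdivrMr //.
  have -> : Lam * m * (p - 1) = lam * ((p - 1) * (Lam / lam * m)).
    by field; rewrite gt_eqF.
  by rewrite ltr_pM2l.
pose be := ga + 1; pose s := - (be / 2).
(* The frame trace of the Hessian of [u] will be [- A u / |x|^2]. *)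
pose A := be * (Lam * m - lam * ga).
have A_gt0 : 0 < A by apply: mulr_gt0; rewrite /be; lra.
pose c := A `^ (p - 1)^-1.
have c_gt0 : 0 < c by apply: powR_gt0.
pose N (x : 'rV[R]_n) := \sum_i x 0 i ^+ 2.
have xjN (x : 'rV[R]_n) : x 0 j ^+ 2 <= N x.
  rewrite /N (bigD1 j) //= lerDl; apply: sumr_ge0 => i _; exact: sqr_ge0.
have N_gt0 (x : 'rV[R]_n) : 0 < x 0 j -> 0 < N x.
  by move=> xj; apply: lt_le_trans (xjN x); rewrite exprn_gt0.
pose u (x : 'rV[R]_n) := c * x 0 j * N x `^ s.
exists u; apply: (@positive_viscosity_solution_frame _ _ _ _ _ _ ('I_1 + 'I_n)%type).
- by move=> x /(_ j jn) xj; rewrite !mulr_gt0 // powR_gt0 // N_gt0.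
- move=> x /(_ j jn) xj.
  have powc := @continuous_comp _ _ _ N (fun r : R => r `^ s) x
    (@sqnorm_continuous _ _ x) (powR_continuous (N_gt0 x xj)).
  have linc := continuousM (@cst_continuous _ _ c x) (@coord_continuous R 1 n 0 j x).
  exact: continuousM linc powc.
move=> x /(_ j jn) xj; have Nx := N_gt0 x xj.
pose b (k : 'I_1 + 'I_n) := if k is inr i then orth_frame x i else x.
(* The radial vector [x] is not normalized, so its weight is divided by [N x]. *)
pose a (k : 'I_1 + 'I_n) := if k is inr i then Lam else lam / N x.
pose q1 k := 2 * \sum_i x 0 i * b k 0 i.
pose q2 k := \sum_i b k 0 i ^+ 2.
exists a, b,
  (fun k t => c * b k 0 j * (N x + q1 k * t + q2 k * t ^+ 2) `^ s +
    (c * x 0 j + c * b k 0 j * t) * (s * (q1 k + 2 * q2 k * t) *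
      (N x + q1 k * t + q2 k * t ^+ 2) `^ (s - 1))),
  (fun k => 2 * (c * b k 0 j) * s * q1 k * N x `^ (s - 1) +
    c * x 0 j * s * ((s - 1) * q1 k ^+ 2 * N x `^ (s - 2) + 2 * q2 k * N x `^ (s - 1))).
split.
- by case=> i; rewrite /a ?divr_ge0 // ltW.
- move=> w; rewrite big_sumType big_ord1 /= -mulr_sumr.
  have dotE (v : 'rV[R]_n) : (v *m w^T) 0 0 = \sum_i w 0 i * v 0 i.
    by rewrite mxE; apply: eq_bigr => i _; rewrite !mxE mulrC.
  under [X in _ + Lam * X]eq_bigr do rewrite dotE.
  rewrite sum_orth_frame_dot_sq ?gt_eqF // dotE -/(N x).
  have orth_ge0 : 0 <= \sum_k (\sum_i w 0 i * orth_frame x k 0 i) ^+ 2.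
    by apply: sumr_ge0 => k _; exact: sqr_ge0.
  move: orth_ge0; rewrite sum_orth_frame_dot_sq ?gt_eqF // -/(N x).
  under [X in lam / N x * X ^+ 2]eq_bigr do rewrite mulrC.
  move: (\sum_i x 0 i * w 0 i) (\sum_i w 0 i ^+ 2) => mw W W_ge.
  have m_ge0 : 0 <= mw ^+ 2 / N x by rewrite divr_ge0 ?sqr_ge0 // ltW.
  have -> : lam / N x * mw ^+ 2 = lam * (mw ^+ 2 / N x) by rewrite mulrAC mulrA.
  (* [r] is the squared radial part of [w], and [lam * r + Lam * (W - r)] is to be compared with
     multiples of [W]. *)
  move: (mw ^+ 2 / N x) m_ge0 W_ge => r r_ge0 rW; apply/andP; split; nra.
- move=> k.
  have [d1 d2] := is_derive_affine_powR (c * x 0 j) (c * b k 0 j) (q1 k) (q2 k) s Nx.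
  split=> //; apply: filterS d1 => t.
  have -> // : (fun t => u (x + t *: b k)) =
    (fun t => (c * x 0 j + c * b k 0 j * t) * (N x + q1 k * t + q2 k * t ^+ 2) `^ s).
  apply/funext => r; rewrite /u /N sqnorm_line; congr (_ * _ `^ _).
  by rewrite !mxE; ring.
- set P1 := N x `^ (s - 1); set P2 := N x `^ (s - 2).
  have NP2 : N x * P2 = P1.
    rewrite /P1 /P2 (_ : s - 1 = 1 + (s - 2)); last by ring.
    rewrite [RHS]powRD; last by rewrite (gt_eqF Nx) implybT.
    by rewrite powRr1 ?(ltW Nx).
  rewrite big_sumType big_ord1 /= -mulr_sumr.
  have radial : 2 * (c * b (inl 0) 0 j) * s * q1 (inl 0) * P1 + c * x 0 j * s *
      ((s - 1) * q1 (inl 0) ^+ 2 * P2 + 2 * q2 (inl 0) * P1) =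
      c * x 0 j * s * N x * P1 * (4 * s + 2).
    have -> : q2 (inl 0) = N x by [].
    have -> : q1 (inl 0) = 2 * N x.
      by rewrite /q1 /=; congr (_ * _); apply: eq_bigr => i _; rewrite expr2.
    by rewrite -NP2 /=; ring.
  have tangential : \sum_i (2 * (c * b (inr i) 0 j) * s * q1 (inr i) * P1 +
      c * x 0 j * s *
      ((s - 1) * q1 (inr i) ^+ 2 * P2 + 2 * q2 (inr i) * P1)) =
      2 * (c * x 0 j) * s * P1 * m.
    rewrite /m -(@sum_orth_frame_sqnorm _ _ x) ?gt_eqF // mulr_sumr.
    apply: eq_bigr => i _.
    (* Orthogonality to [x] removes the first-order change of [|x|^2], so only the [q2] term
       survives. *)
    have -> : q1 (inr i) = 0 by rewrite /q1 orth_frame_dot_self ?gt_eqF // mulr0.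
    by rewrite /q2 /=; ring.
  rewrite radial tangential.
  have -> : lam / N x * (c * x 0 j * s * N x * P1 * (4 * s + 2)) +
      Lam * (2 * (c * x 0 j) * s * P1 * m) = - (c * A * (x 0 j * P1)).
    by rewrite /A /s /be; field; rewrite gt_eqF.
  (* After the common factors [c A] and [x_n] cancel, what remains is [x_n^(p - 1) <= |x|^(p - 1)],
     by the identity [s - 1 = (p - 1) / 2 + s p]. *)
  rewrite addrC subr_le0 /u -mulrA powRM ?(ltW c_gt0) ?mulr_ge0 ?powR_ge0 ?(ltW xj) //.
  rewrite powR_balance //; last by rewrite gt_eqF //; lra.
  rewrite ler_pM2l; last by rewrite mulr_gt0.
  rewrite powRM ?powR_ge0 ?(ltW xj) // -powRrM -(mulr_powRB1 (ltW xj)); last lra.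
  rewrite -mulrA ler_pM2l //.
  have -> : P1 = N x `^ ((p - 1) / 2) * N x `^ (s * p).
    rewrite -powRD; last by rewrite (gt_eqF Nx) implybT.
    by congr (_ `^ _); rewrite /s /be /ga; field; rewrite gt_eqF.
  rewrite ler_pM2r ?powR_gt0 //.
  have -> : x 0 j `^ (p - 1) = (x 0 j ^+ 2) `^ ((p - 1) / 2).
    rewrite -powR_mulrn ?(ltW xj) // -powRrM; congr (_ `^ _); by field.
  have q_ge0 : 0 <= (p - 1) / 2 by rewrite divr_ge0 // ltW.
  by apply: (ge0_ler_powR q_ge0); rewrite ?nnegrE ?sqr_ge0 ?(ltW Nx).
Qed.

Theorem mainTheorem5 (R : realType) (n : nat) (lam Lam p : R)
    (hn : (2 <= n)%N) (hlam : 0 < lam) (hLam : lam <= Lam)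
    (hp : p < -1 \/
          (Lam / lam * (n%:R - 1) + 2) / (Lam / lam * (n%:R - 1)) < p) :
  exists u : 'rV[R]_n -> R, positive_viscosity_solution lam Lam p u.
Proof.
case: hp => [p_lt|p_gt].
  by apply: exists_solution_small_exponent p_lt => //; exact: ltnW.
exact: exists_solution_large_exponent p_gt.
Qed.
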